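(* Let $q:F\to G$ be a surjective homomorphism of groups. Then $q$ induces an embedding $$q^{\dagger}:\mathrm{Hom}_{\mathbf{Kl}(\mathscr P_+)}(1,G)\hookrightarrow \mathrm{Hom}_{\mathbf{Kl}(\mathscr P_+)}(1,F)$$ (that is, an injective map preserving the convolution $\star$) which sends each Kleisli point $f_A:1=\{*\}\rightsquigarrow G$, defined by $f_A( * )=A$ with $\varnothing\neq A\subseteq G$, to the Kleisli point $f_{q^{-1}(A)}:1\rightsquigarrow F$ defined by $f_{q^{-1}(A)}( * )=q^{-1}(A)\subseteq F$.
   Context: For a set $X$, $\mathcal P_+(X)$ is the set of all non-empty subsets of $X$. $\mathscr P_+=(\mathcal P_+,\eta,\mu)$ is the non-empty powerset monad on sets: $\mathcal P_+$ acts on maps by direct image, $\eta_X(x)=\{x\}$, $\mu_X(\mathcal A)=\bigcup_{A\in\mathcal A}A$. In its Kleisli category $\mathbf{Kl}(\mathscr P_+)$ the objects are sets, a morphism $f:X\rightsquigarrow Y$ is a map $f:X\to\mathcal P_+(Y)$, and the composite of $f:X\rightsquigarrow Y$ and $g:Y\rightsquigarrow Z$ is $x\mapsto\bigcup_{y\in f(x)}g(y)$. The tensor product is $X\otimes Y=X\times Y$ and $(f\otimes g)(x,x')=f(x)\times g(x')$; an ordinary map $h$ is regarded as the Kleisli arrow $x\mapsto\{h(x)\}$. $1=\{*\}$ is a one-point set. A Kleisli point of $X$ is a morphism $1\rightsquigarrow X$ in $\mathbf{Kl}(\mathscr P_+)$. For a group $G$ with multiplication $m$, and $\Delta:1\to1\times1$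 the diagonal, the convolution on $\mathrm{Hom}_{\mathbf{Kl}(\mathscr P_+)}(1,G)$ is the Kleisli composite $f\star g=m\circ(f\otimes g)\circ\Delta$. For $A\subseteq G$, $q^{-1}(A)=\{x\in F:q(x)\in A\}$. *)

(* Defs.v *)
From HB Require Import structures.
From mathcomp Require Import all_boot.
From mathcomp Require Import boolp classical_sets functions.

Set Implicit Arguments.
Unset Strict Implicit.
Unset Printing Implicit Defensive.

Local Open Scope classical_set_scope.

Definition pow_plus (X : Type) : Type := {A : set X | A !=set0}.

Lemma pow_plus_unit_nonempty (X : Type) (x : X) : [set x] !=set0.
Proof. by exists x. Qed.

Definition pow_plus_unit (X : Type) (x : X) : pow_plus X :=
  exist _ [set x] (pow_plus_unit_nonempty x).

Definition kl_hom (X Y : Type) : Type := X -> pow_plus Y.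

Lemma kl_comp_nonempty (X Y Z : Type) (g : kl_hom Y Z) (f : kl_hom X Y)
    (x : X) : \bigcup_(y in sval (f x)) sval (g y) !=set0.
Proof.
by have [y fxy] := svalP (f x); have [z gyz] := svalP (g y); exists z, y.
Qed.

(* Arguments in the order of "g after f". *)
Definition kl_comp (X Y Z : Type) (g : kl_hom Y Z) (f : kl_hom X Y) :
    kl_hom X Z :=
  fun x => exist _ (\bigcup_(y in sval (f x)) sval (g y))
                   (kl_comp_nonempty g f x).

Lemma kl_tensor_nonempty (X X' Y Y' : Type) (f : kl_hom X Y)
    (g : kl_hom X' Y') (p : X * X') :
  sval (f p.1) `*` sval (g p.2) !=set0.
Proof.
by have [y fy] := svalP (f p.1); have [z gz] := svalP (g p.2); exists (y, z).
Qed.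

Definition kl_tensor (X X' Y Y' : Type) (f : kl_hom X Y) (g : kl_hom X' Y') :
    kl_hom (X * X') (Y * Y') :=
  fun p => exist _ (sval (f p.1) `*` sval (g p.2)) (kl_tensor_nonempty f g p).

Definition kl_map (X Y : Type) (h : X -> Y) : kl_hom X Y :=
  fun x => pow_plus_unit (h x).

Definition kl_point (X : Type) (A : set X) (hA : A !=set0) : kl_hom unit X :=
  fun _ => exist _ A hA.

Definition kl_conv (G : groupType) (f g : kl_hom unit G) : kl_hom unit G :=
  kl_comp (kl_map (fun p : G * G => (p.1 * p.2)%g))
    (kl_comp (kl_tensor f g) (kl_map (fun t : unit => (t, t)))).

(* Main.v *)
(** Taking preimages under [q] is injective because [q] is onto, and it respects
    products of subsets: if [q x = a * b] and [q u = a], then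
    [x = u * (u^-1 * x)] with [q (u^-1 * x) = b]. *)
Require Import Defs.
From HB Require Import structures.
From mathcomp Require Import all_boot.
From mathcomp Require Import boolp classical_sets functions.

Local Open Scope classical_set_scope.

Lemma kl_hom_eq (X Y : Type) (f g : kl_hom X Y) :
  (forall x, sval (f x) = sval (g x)) -> f = g.
Proof. by move=> fg; apply/funext => x; apply: eq_sig_hprop (fg x) => ? ? ?; exact: Prop_irrelevance. Qed.

(** The diagonal yields only the pair [(t, t)], the tensor turns it into a rectangle, and
    multiplication takes the image of that rectangle. *)
Lemma sval_kl_conv (G : groupType) (f g : kl_hom unit G) (t : unit) :
  sval (kl_conv f g t) =
  [set (x * y)%g | x in sval (f t) & y in sval (g t)].
Proof.
apply/seteqP; split=> z /=.
- by move=> [[x y] [_ -> [/= fx gy]] ->]; exists x => //; exists y.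
- by move=> [x fx [y gy <-]]; exists (x, y) => //; exists (t, t).
Qed.

Section Preimage.
Variables (F G : groupType) (q : {multiplicative F -> G}).
Hypothesis q_surj : set_surj [set: F] [set: G] q.

Lemma preimage_mulg (A B : set G) :
  q @^-1` [set (a * b)%g | a in A & b in B] =
  [set (x * y)%g | x in q @^-1` A & y in q @^-1` B].
Proof.
apply/seteqP; split=> x /=.
- move=> [a Aa [b Bb abE]]; have [u _ ua] := q_surj a I.
  exists u; first by rewrite /= ua.
  exists (u^-1 * x)%g; last by rewrite mulVKg.
  suff -> : q (u^-1 * x)%g = b by [].
  (* Multiplied on the left by [q u = a], both sides become [q x = a * b]. *)
  by apply: (@mulgI _ (q u)); rewrite -gmulfM mulVKg ua abE.
- by move=> [u Au [v Bv <-]]; exists (q u) => //; exists (q v); rewrite ?gmulfM.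
Qed.

Lemma preimage_nonempty (A : set G) : A !=set0 -> q @^-1` A !=set0.
Proof. by move=> [a Aa]; have [x _ xa] := q_surj a I; exists x; rewrite /= xa. Qed.

Definition kl_preimage (f : kl_hom unit G) : kl_hom unit F :=
  fun t => exist _ (q @^-1` sval (f t)) (preimage_nonempty _ (svalP (f t))).

(** Direct image is a left inverse: since [q] is onto, the image of the preimage of a set is that
    set. *)
Lemma kl_preimage_inj : injective kl_preimage.
Proof.
move=> f g fg; apply: kl_hom_eq => t.
have fgt : q @^-1` sval (f t) = q @^-1` sval (g t).
  by rewrite -[LHS]/(sval (kl_preimage f t)) fg.
have qT : q @` [set: F] = [set: G] by apply/seteqP; split.
by rewrite -(image_preimage (sval (f t)) qT) fgt image_preimage.
Qed.

Lemma kl_preimage_conv (f g : kl_hom unit G) :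
  kl_preimage (kl_conv f g) = kl_conv (kl_preimage f) (kl_preimage g).
Proof.
by apply: kl_hom_eq => t; rewrite sval_kl_conv -preimage_mulg -sval_kl_conv.
Qed.

End Preimage.

Theorem theorem2 (F G : groupType) (q : {multiplicative F -> G})
    (q_surj : set_surj [set: F] [set: G] q) :
  exists q_dag : kl_hom unit G -> kl_hom unit F,
    [/\ injective q_dag,
        forall f g : kl_hom unit G,
          q_dag (kl_conv f g) = kl_conv (q_dag f) (q_dag g)
      & forall (A : set G) (hA : A !=set0),
          exists hqA : (q @^-1` A) !=set0,
            q_dag (kl_point hA) = kl_point hqA].
Proof.
exists (kl_preimage F G q q_surj); split.
- exact: kl_preimage_inj.
- exact: kl_preimage_conv.
- by move=> A hA; exists (preimage_nonempty F G q q_surj A hA); apply: kl_hom_eq.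
Qed.
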